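(* Let $k$ be a field, $S=k[x_1,\ldots,x_n]$, and let $\Delta$ be a simplicial forest with vertices in $\{x_1,\ldots,x_n\}$ and facet ideal $I\subseteq S$. Suppose $i$ is at most the projective dimension of $S/I$, and $i=a+b$ where $a,b>0$ are integers. Then $$t_a(I)+t_b(I)\geq t_{a+b}(I).$$
   Context: A simplicial complex $\Delta$ is a set of subsets (faces) of a finite set closed under taking subsets; its facets are the inclusion-maximal faces, and $\Delta=\langle F_1,\ldots,F_q\rangle$ means that $F_1,\ldots,F_q$ are the facets of $\Delta$. A subcollection of $\Delta$ is a simplicial complex whose facets are facets of $\Delta$. A facet $F$ of $\Delta$ is a leaf if either $F$ is the only facet of $\Delta$, or there is a facet $G\neq F$ of $\Delta$ such that $F\cap H\subseteq G$ for every facet $H\neq F$ of $\Delta$. $\Delta$ is a simplicial forest if every nonempty subcollection of $\Delta$ has a leaf. Facet ideal: for $u\subseteq\{x_1,\ldots,x_n\}$ let $\mathbf{m}_u=\prod_{x_i\in u}x_i$. The facet ideal of $\Delta$ is the ideal $(\mathbf{m}_F : F \text{ a facet of }\Delta)$ of $S$. For a graded ideal $I\subseteq S$, $\beta_{i,j}(S/I)$ denotes the graded Betti number of $S/I$, i.e. the rank of the summand $S(-j)$ in homological degree $i$ of the minimal graded free resolution of $S/I$ over $S$ (with $S$ in homological degree $0$), and $t_a(I)=\max\{j : \beta_{a,j}(S/I)\neq 0\}$. *)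

(* Defs.v *)
From HB Require Import structures.
From mathcomp Require Import all_boot all_order all_algebra.
From mathcomp Require Export mpoly.

Set Implicit Arguments.
Unset Strict Implicit.
Unset Printing Implicit Defensive.

Import GRing.Theory.
Local Open Scope ring_scope.

Section Complexes.
Variable T : finType.
Implicit Types (D E : {set {set T}}) (F G H : {set T}).

Definition simplicial_complex D : Prop :=
  forall F G, F \in D -> G \subset F -> G \in D.

Definition facets D : {set {set T}} := [set F | maxset (fun G => G \in D) F].

Definition subcollection E D : Prop :=
  simplicial_complex E /\ facets E \subset facets D.

Definition leaf D F : Prop :=
  F \in facets D /\
  (facets D = [set F] \/
   exists G, [/\ G \in facets D, G != F &
     forall H, H \in facets D -> H != F -> F :&: H \subset G]).

Definition simplicial_forest D : Prop :=
  simplicial_complex D /\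
  forall E, subcollection E D -> E != set0 -> exists F, leaf E F.

End Complexes.

Section FacetIdeal.
Variables (k : fieldType) (n : nat).

Definition mon_of (u : {set 'I_n}) : {mpoly k[n]} := \prod_(x in u) 'X_x.

Definition facet_ideal (D : {set {set 'I_n}}) (f : {mpoly k[n]}) : Prop :=
  exists c : {set 'I_n} -> {mpoly k[n]},
    f = \sum_(F in facets D) c F * mon_of F.

(* The module in homological degree i is the direct sum of the S(- shift i p),
   p < rank i, with elements written as row vectors; dif i is the differential
   from homological degree i.+1 to i, acting by right multiplication.
   Natural-number shifts lose nothing: the module in degree 0 is S, and in a
   minimal resolution the smallest shift strictly increases at each step. *)
Record min_graded_free_res (I : {mpoly k[n]} -> Prop) := MinGradedFreeRes {
  rank : nat -> nat;
  shift : forall i, 'I_(rank i) -> nat;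
  dif : forall i, 'M[{mpoly k[n]}]_(rank i.+1, rank i);
  rank0 : rank 0 = 1%N;
  shift0 : forall q : 'I_(rank 0), shift q = 0%N;
  (* the entry (p, q) is zero or homogeneous of degree shift p - shift q *)
  dif_graded : forall i p q m,
    m \in msupp (dif i p q) -> (mdeg m + shift q)%N = shift p;
  (* since rank 0 = 1, this says that the image of dif 0 is I *)
  exact0 : forall v : 'rV_(rank 0),
    (forall q, I (v 0 q)) <-> exists w, v = w *m dif 0;
  exactS : forall i (v : 'rV_(rank i.+1)),
    v *m dif i = 0 <-> exists w, v = w *m dif i.+1;
  (* all entries lie in the ideal (x_1, ..., x_n) *)
  dif_minimal : forall i p q, (dif i p q)@_0%MM = 0
}.

Section Invariants.
Variables (I : {mpoly k[n]} -> Prop) (F : min_graded_free_res I).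

Definition betti (i j : nat) : nat := #|[set p : 'I_(rank F i) | shift p == j]|.

(* The projective dimension of S/I is the length of its minimal free resolution. *)
Definition projdim (p : nat) : Prop :=
  rank F p != 0%N /\ forall i, (p < i)%N -> rank F i = 0%N.

(* max {j | betti a j != 0}: every such j is one of the shifts in homological
   degree a, so it is enough to let j range over these; see max_degreeP. *)
Definition max_degree (a : nat) : nat :=
  \max_(j <- codom (@shift I F a) | betti a j != 0%N) j.

Lemma betti_neq0 i j : (betti i j != 0%N) = (j \in codom (@shift I F i)).
Proof.
rewrite -lt0n; apply/card_gt0P/codomP => [[p]|[p ->]].
  by rewrite inE => /eqP <-; exists p.
by exists p; rewrite inE.
Qed.

Lemma max_degreeP a : rank F a != 0%N ->
  betti a (max_degree a) != 0%N /\
  forall j, betti a j != 0%N -> (j <= max_degree a)%N.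
Proof.
move=> rk; split=> [|j bj]; last first.
  by apply: (@leq_bigmax_seq _ _ _ id) => //; rewrite -betti_neq0.
have q : 'I_(rank F a) by apply: Ordinal (_ : 0 < _)%N; rewrite lt0n.
rewrite betti_neq0 /max_degree -big_filter.
have -> : [seq j <- codom (@shift I F a) | betti a j != 0%N]
          = codom (@shift I F a).
  by apply/all_filterP/allP => j; rewrite betti_neq0.
have : codom (@shift I F a) != [::].
  by apply/eqP => e; have := codom_f (@shift I F a) q; rewrite e.
elim: (codom _) => // x [|y s] IH _; first by rewrite big_seq1 mem_head.
rewrite big_cons; case: leqP => _; last by rewrite mem_head.
by rewrite inE IH ?orbT.
Qed.

Lemma projdim_rank_neq0 p :
  projdim p -> forall i, (i <= p)%N -> rank F i != 0%N.
Proof.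
case=> rkp _ i le_ip; apply: contra_neq rkp => rki.
rewrite -(subnKC le_ip); elim: (p - i)%N => [|d rkd]; first by rewrite addn0.
rewrite addnS; move: (i + d)%N rkd => j rkj {d}.
apply/eqP; case: posnP => // rkS; exfalso.
pose r : 'I_(rank F j.+1) := Ordinal rkS.
have rj0 : delta_mx 0 r *m dif F j = 0 :> 'rV_(rank F j).
  by apply/matrixP => x y; have := ltn_ord y; rewrite [X in (_ < X)%N]rkj.
have [w /matrixP /(_ 0 r)] := (exactS (delta_mx 0 r)).1 rj0.
rewrite !mxE !eqxx /= => /(congr1 (mcoeff 0%MM)).
rewrite mcoeff1 eqxx raddf_sum big1 => [/eqP|l _]; first by rewrite oner_eq0.
by rewrite [LHS](rmorphM (mcoeff 0%MM)) [X in _ * X](dif_minimal l r) mulr0.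
Qed.

End Invariants.
End FacetIdeal.

(* Main.v *)
Require Import Defs.
From HB Require Import structures.
From mathcomp Require Import all_boot all_order all_algebra.

(* A leaf F of a forest which is an antichain A contains a vertex x lying in no
   other facet.  With J generated by A - {F}, the mapping cone of
   S/(J : m_F)(-F) -> S/J resolves S/I, and it is minimal since x divides the
   multidegrees coming from the first complex and none of the second.  As
   J : m_F is generated by the sets H - F, again a forest, every generator in
   homological degree a + b is either one of S/J, and induction applies, or F
   times a generator of S/(J : m_F) in degree (a - 1) + b.  In the second case
   induction (for a > 1) gives degrees a - 1 and b for S/(J : m_F); the former
   yields degree a for S/I after multiplication by F.  For the latter, setting
   the variables of F to 1 in the resolution of S/J gives a possibly non-minimal
   resolution of S/(J : m_F), so that t_b(J : m_F) <= t_b(J) <= t_b(I).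

   All ideals being squarefree, the multigraded resolutions are encoded by
   matrices over k and subsets of the vertex set. *)

Set Implicit Arguments.
Unset Strict Implicit.
Unset Printing Implicit Defensive.

Import GRing.Theory.

(** * Comparison of graded free resolutions *)

Section GradedResolutions.
Local Open Scope ring_scope.
Variables (k : fieldType) (n : nat).
Local Notation S := {mpoly k[n]}.

(** Minimality is kept separate, since setting variables to 1 can destroy it. *)
Record graded_free_res (I : S -> Prop) := GradedFreeRes {
  grank : nat -> nat;
  gshift : forall i, 'I_(grank i) -> nat;
  gdif : forall i, 'M[S]_(grank i.+1, grank i);
  grank0 : grank 0 = 1%N;
  gshift0 : forall q : 'I_(grank 0), gshift q = 0%N;
  gdif_graded : forall i p q m,
    m \in msupp (gdif i p q) -> (mdeg m + gshift q)%N = gshift p;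
  gexact0 : forall v : 'rV_(grank 0),
    (forall q, I (v 0 q)) <-> exists w, v = w *m gdif 0;
  gexactS : forall i (v : 'rV_(grank i.+1)),
    v *m gdif i = 0 <-> exists w, v = w *m gdif i.+1
}.

Definition gminimal I (G : graded_free_res I) : Prop :=
  forall i p q, (gdif G i p q)@_0%MM = 0.

Lemma mcoeff_msupp_filter (P : pred 'X_{1..n}) (f : S) m :
  (\sum_(m' <- msupp f | P m') f@_m' *: 'X_[m'])@_m = if P m then f@_m else 0.
Proof.
rewrite raddf_sum /=.
under eq_bigr => m' _ do rewrite mcoeffZ mcoeffX.
case: ifP => Pm; last first.
  rewrite big1 // => m' Pm'; case: eqP => [e|]; last by rewrite mulr0.
  by rewrite -e Pm' in Pm.
case: (boolP (m \in msupp f)) => [fm|]; last first.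
  rewrite mcoeff_msupp negbK => /eqP f0; rewrite f0; apply: big1 => m' _.
  by case: eqP => [->|]; rewrite ?f0 ?mul0r ?mulr0.
rewrite big_mkcond (bigD1_seq m) ?msupp_uniq //= Pm eqxx mulr1 big1 ?addr0 //.
by move=> m' /negPf ->; rewrite mulr0 if_same.
Qed.

Definition homog_mx r s (sh : 'I_r -> nat) (sh' : 'I_s -> nat) (M : 'M[S]_(r, s)) :=
  forall p q m, m \in msupp (M p q) -> (mdeg m + sh' q)%N = sh p.

Lemma homog_mulmx r s t (sh : 'I_r -> nat) (sh' : 'I_s -> nat)
    (sh'' : 'I_t -> nat) (M : 'M[S]_(r, s)) (N : 'M[S]_(s, t)) :
  homog_mx sh sh' M -> homog_mx sh' sh'' N -> homog_mx sh sh'' (M *m N).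
Proof.
move=> hM hN p q m; rewrite !mxE => /msupp_sum_le /flatten_mapP[j _].
move=> /msuppM_le /allpairsP[[m1 m2] /= [h1 h2 ->]].
by rewrite mdegD -addnA (hN _ _ _ h2) (hM _ _ _ h1).
Qed.

(** Only the terms of the degrees prescribed by [sh] and [sh'] are kept in [W]; the others
    contribute to degrees in which [W *m N] vanishes. *)
Lemma homog_factor r s t (sh : 'I_r -> nat) (sh' : 'I_s -> nat)
    (sh'' : 'I_t -> nat) (W : 'M[S]_(r, s)) (N : 'M[S]_(s, t)) :
  homog_mx sh' sh'' N -> homog_mx sh sh'' (W *m N) ->
  exists2 W', homog_mx sh sh' W' & W *m N = W' *m N.
Proof.
move=> hN hWN.
pose P p q (m : 'X_{1..n}) := (mdeg m + sh' q)%N == sh p.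
exists (\matrix_(p, q) \sum_(m <- msupp (W p q) | P p q m) (W p q)@_m *: 'X_[m]).
  move=> p q m; rewrite mxE mcoeff_msupp mcoeff_msupp_filter /P.
  by case: ifP => [/eqP //|_]; rewrite eqxx.
apply/matrixP => p q; apply/mpolyP => m; rewrite !mxE !raddf_sum /=.
have [e|ne] := eqVneq (mdeg m + sh'' q)%N (sh p).
  apply: eq_bigr => j _; rewrite !mcoeffM; apply: eq_bigr => mm /eqP em.
  rewrite mxE mcoeff_msupp_filter; case: ifP => //= /negP nP.
  have [->|N0] := eqVneq ((N j q)@_mm.2) 0; first by rewrite !mulr0.
  case: nP; rewrite /P -(hN j q mm.2) ?mcoeff_msupp //.
  by rewrite addnA -mdegD -em e.
have -> : \sum_j (W p j * N j q)@_m = 0.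
  rewrite -raddf_sum /=; have := hWN p q m; rewrite mxE mcoeff_msupp.
  by case: eqP => // _ /(_ isT) e; rewrite e eqxx in ne.
symmetry; apply: big1 => j _; rewrite mcoeffM; apply: big1 => mm /eqP em.
rewrite mxE mcoeff_msupp_filter; case: ifP => [/eqP P0|]; last by rewrite mul0r.
have [->|N0] := eqVneq ((N j q)@_mm.2) 0; first by rewrite mulr0.
move/eqP: ne; case; rewrite em mdegD -addnA (hN j q mm.2) ?mcoeff_msupp //.
Qed.

Lemma factor_rows r s t (M : 'M[S]_(r, t)) (N : 'M[S]_(s, t)) :
  (forall p, exists w, row p M = w *m N) -> exists W, M = W *m N.
Proof.
case/fin_all_exists => f hf; exists (\matrix_p f p).
by apply/row_matrixP => p; rewrite row_mul rowK.
Qed.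

Section Lifting.
Variables (I : S -> Prop) (G : graded_free_res I).

Lemma gdif_gdif i : gdif G i.+1 *m gdif G i = 0.
Proof.
apply/row_matrixP => p; rewrite row_mul row0.
by apply/gexactS; exists (delta_mx 0 p); rewrite rowE.
Qed.

Lemma gdif_factorS i r (M : 'M[S]_(r, grank G i.+1)) :
  M *m gdif G i = 0 -> exists W, M = W *m gdif G i.+1.
Proof.
move=> M0; apply: factor_rows => p.
by apply/gexactS; rewrite -row_mul M0 row0.
Qed.

Lemma gdif_factor0 r (M : 'M[S]_(r, grank G 0)) :
  (forall p q, I (M p q)) -> exists W, M = W *m gdif G 0.
Proof.
by move=> IM; apply: factor_rows => p; apply/gexact0 => q; rewrite mxE.
Qed.

Lemma gdif0_in p q : I (gdif G 0 p q).
Proof.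
have /gexact0/(_ q) : exists w, row p (gdif G 0) = w *m gdif G 0.
  by exists (delta_mx 0 p); rewrite rowE.
by rewrite mxE.
Qed.

Lemma grank0_unique (q q' : 'I_(grank G 0)) : q = q'.
Proof.
have q0 (x : 'I_(grank G 0)) : val x = 0%N.
  by have := ltn_ord x; rewrite [X in (_ < X)%N]grank0 ltnS leqn0 => /eqP.
by apply: val_inj; rewrite !q0.
Qed.

Lemma sum_grank0 (V : nmodType) (f : 'I_(grank G 0) -> V) q : \sum_j f j = f q.
Proof.
rewrite (bigD1 q) //= big1 ?addr0 // => j; by rewrite (grank0_unique j q) eqxx.
Qed.

Lemma grank0_ord : exists q : 'I_(grank G 0), true.
Proof.
have h : (0 < grank G 0)%N by rewrite grank0.
by exists (Ordinal h).
Qed.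

End Lifting.

Section Comparison.
Variables (I : S -> Prop) (G H : graded_free_res I).

Lemma const_mx1_mulmx :
  (const_mx 1 : 'M[S]_(grank G 0, grank H 0)) *m const_mx 1 = 1%:M.
Proof.
case: (grank0_ord H) => q0 _.
apply/matrixP => p q; rewrite (grank0_unique p q) !mxE (sum_grank0 _ q0).
by rewrite !mxE mulr1 eqxx.
Qed.

(** Both modules in degree 0 are [S], identified by [const_mx 1]; the entries of [gdif G 0] lie in
    [I] and so lift through [gdif H 0]. *)
Lemma comparison0 : exists2 W : 'M[S]_(grank G 1, grank H 1),
  homog_mx (@gshift _ G 1) (@gshift _ H 1) W &
  W *m gdif H 0 = gdif G 0 *m const_mx 1.
Proof.
have [|W eW] := @gdif_factor0 _ H _ (gdif G 0 *m const_mx 1).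
  move=> p q; have [q0 _] := grank0_ord G.
  by rewrite mxE (sum_grank0 _ q0) mxE mulr1; apply: gdif0_in.
have [W' hW' eW'] : exists2 W', homog_mx (@gshift _ G 1) (@gshift _ H 1) W'
    & W *m gdif H 0 = W' *m gdif H 0.
  apply: (@homog_factor _ _ _ _ _ (@gshift _ H 0)).
    exact: (@gdif_graded _ H).
  rewrite -eW; apply: (@homog_mulmx _ _ _ _ (@gshift _ G 0)).
    exact: (@gdif_graded _ G).
  move=> p q m; rewrite mxE mcoeff_msupp mcoeff1.
  by case: (m =P 0%MM) => [->|]; rewrite ?eqxx // mdeg0 !gshift0.
by exists W'; rewrite // eW eW'.
Qed.

Lemma comparisonS i (W0 : 'M[S]_(grank G i, grank H i)) (W1 : 'M[S]_(_, _)) :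
  homog_mx (@gshift _ G i.+1) (@gshift _ H i.+1) W1 ->
  W1 *m gdif H i = gdif G i *m W0 ->
  exists2 W, homog_mx (@gshift _ G i.+2) (@gshift _ H i.+2) W &
    W *m gdif H i.+1 = gdif G i.+1 *m W1.
Proof.
move=> hW1 e.
have [|W eW] := @gdif_factorS _ H i _ (gdif G i.+1 *m W1).
  by rewrite -mulmxA e mulmxA gdif_gdif mul0mx.
have [W' hW' eW'] : exists2 W', homog_mx (@gshift _ G i.+2) (@gshift _ H i.+2) W'
    & W *m gdif H i.+1 = W' *m gdif H i.+1.
  apply: (@homog_factor _ _ _ _ _ (@gshift _ H i.+1)).
    exact: (@gdif_graded _ H).
  rewrite -eW; apply: (@homog_mulmx _ _ _ _ (@gshift _ G i.+1)) => //.
  exact: (@gdif_graded _ G).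
by exists W'; rewrite // eW eW'.
Qed.

End Comparison.

Lemma mcoeff0_mulmx r s t (M : 'M[S]_(r, s)) (N : 'M[S]_(s, t)) p q :
  ((M *m N) p q)@_0%MM = \sum_j (M p j)@_0%MM * (N j q)@_0%MM.
Proof.
by rewrite mxE raddf_sum; apply: eq_bigr => j _; apply: (rmorphM (mcoeff 0%MM)).
Qed.

(* [s] is the homotopy from the identity of [G] to the composite [phi psi] of
   the two comparison maps. *)
Lemma comparison_homotopy I (G H : graded_free_res I) i :
  exists phi0 phi1 psi0 psi1 s,
    [/\ homog_mx (@gshift _ G i.+1) (@gshift _ H i.+1) phi1 /\
        homog_mx (@gshift _ H i.+1) (@gshift _ G i.+1) psi1,
        phi1 *m gdif H i = gdif G i *m phi0,
        psi1 *m gdif G i = gdif H i *m psi0 &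
        (1%:M - phi1 *m psi1 - gdif G i *m s) *m gdif G i = 0].
Proof.
elim: i => [|i [phi0 [phi1 [psi0 [psi1 [s [[hphi hpsi] ephi epsi es]]]]]]].
  have [phi1 hphi ephi] := comparison0 G H.
  have [psi1 hpsi epsi] := comparison0 H G.
  exists (const_mx 1), phi1, (const_mx 1), psi1, 0; split=> //.
  rewrite mulmx0 subr0 mulmxBl mul1mx -mulmxA epsi mulmxA ephi -mulmxA.
  by rewrite const_mx1_mulmx mulmx1 subrr.
have [phi2 hphi2 ephi2] := comparisonS hphi ephi.
have [psi2 hpsi2 epsi2] := comparisonS hpsi epsi.
(* The error term is a cycle, hence a boundary, and [s'] is the next component of the homotopy. *)
have [s' es'] := gdif_factorS es.
exists phi1, phi2, psi1, psi2, s'; split=> //.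
rewrite !mulmxBl mul1mx -[_ *m gdif G i.+1]mulmxA epsi2 mulmxA ephi2.
rewrite -[gdif G i.+1 *m s' *m _]mulmxA -es' !mulmxBr mulmx1 !mulmxA gdif_gdif.
by rewrite mul0mx subr0 subrr.
Qed.

(* As [G] is minimal, the homotopy vanishes modulo the variables, so the
   composite comparison map [phi psi] is the identity there: some entry
   [phi p q] has a non-zero constant term. *)
Lemma gminimal_shift I (G H : graded_free_res I) (minG : gminimal G) i
    (p : 'I_(grank G i)) : exists q : 'I_(grank H i), gshift q = gshift p.
Proof.
case: i p => [|i] p.
  by have [q _] := grank0_ord H; exists q; rewrite !gshift0.
have [phi0 [phi1 [psi0 [psi1 [s [[hphi _] _ _ es]]]]]] :=
  comparison_homotopy G H i.
have [s' /matrixP/(_ p p)/(congr1 (mcoeff 0%MM))] := gdif_factorS es.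
rewrite (_ : (1%:M - phi1 *m psi1 - gdif G i *m s) p p =
  1 - (phi1 *m psi1) p p - (gdif G i *m s) p p); last by rewrite !mxE eqxx.
rewrite !mcoeffB mcoeff1 eqxx !mcoeff0_mulmx.
rewrite [X in _ - X = _]big1 => [|j _]; last by rewrite minG mul0r.
rewrite [X in _ = X]big1 => [|j _]; last by rewrite minG mulr0.
have [q /= q0|noq] := pickP [pred q | (phi1 p q)@_0%MM != 0].
  by exists q; rewrite -(hphi p q 0%MM) ?mdeg0 // mcoeff_msupp.
rewrite big1 => [/eqP|j _]; first by rewrite !subr0 oner_eq0.
by have /negbFE/eqP -> := noq j; rewrite mul0r.
Qed.

End GradedResolutions.

(** * Squarefree multigraded complexes *)

Section LabelledComplexes.
Local Open Scope ring_scope.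
Variables (k : fieldType) (T : finType).

(* A squarefree multigraded complex of free modules: [lab p] is the multidegree
   of the generator [p], and the entry [(p, q)] of the differential in degree
   [i] is the scalar [df i p q] times the monomial [lab p / lab q]. *)
Record labelled_complex := LabelledComplex {
  rk : nat -> nat;
  lab : forall i, 'I_(rk i) -> {set T};
  df : forall i, 'M[k]_(rk i.+1, rk i)
}.

Definition supported (K : labelled_complex) i (w : {set T}) (v : 'rV[k]_(rk K i)) :=
  forall q, v 0 q != 0 -> lab q \subset w.

(* [K] resolves the quotient by the ideal whose squarefree monomials are those
   in [U]: in each multidegree [w], the vector spaces spanned by the generators
   dividing [w] form an exact complex. *)
Record resolves (K : labelled_complex) (U : pred {set T}) : Prop := Resolves {
  res_rk0 : rk K 0 = 1%N;
  res_lab0 : forall q : 'I_(rk K 0), lab q = set0;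
  res_sub : forall i (p : 'I_(rk K i.+1)) (q : 'I_(rk K i)),
    df K i p q != 0 -> lab q \subset lab p;
  res_df_df : forall i, df K i.+1 *m df K i = 0;
  res_onto : forall w (v : 'rV_(rk K 0)), U w ->
    exists2 v' : 'rV_(rk K 1), supported w v' & v = v' *m df K 0;
  res_image : forall w (v : 'rV_(rk K 1)),
    supported w v -> v *m df K 0 != 0 -> U w;
  res_exact : forall i w (v : 'rV_(rk K i.+1)), supported w v -> v *m df K i = 0 ->
    exists2 v' : 'rV_(rk K i.+2), supported w v' & v = v' *m df K i.+1
}.

(** A non-zero entry between equal labels would be a unit. *)
Definition lminimal (K : labelled_complex) : Prop :=
  forall i (p : 'I_(rk K i.+1)) (q : 'I_(rk K i)),
    df K i p q != 0 -> lab q != lab p.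

Lemma eq_resolves K (U U' : pred {set T}) : U =1 U' -> resolves K U -> resolves K U'.
Proof.
move=> eU [? ? ? ? h1 h2 ?]; split=> // [w v|w v hv]; rewrite -eU; first exact: h1.
exact: h2.
Qed.

(** These are the squarefree monomials of the ideal generated by [A]. *)
Definition up (A : {set {set T}}) (w : {set T}) : bool := [exists H in A, H \subset w].

End LabelledComplexes.

Section Monomials.
Variable n : nat.

Definition mset (u : {set 'I_n}) : 'X_{1..n} := [multinom (x \in u : nat) | x < n].

Definition supp (m : 'X_{1..n}) : {set 'I_n} := [set x | m x != 0].

Lemma mdeg_mset u : mdeg (mset u) = #|u|.
Proof.
rewrite mdegE -sum1_card [RHS]big_mkcond; apply: eq_bigr => x _.
by rewrite mnmE; case: (x \in u).
Qed.

Lemma msetD (u v : {set 'I_n}) : v \subset u -> (mset (u :\: v) + mset v)%MM = mset u.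
Proof.
move/subsetP=> vu; apply/mnmP => x; rewrite mnmDE !mnmE inE.
by case: (boolP (x \in v)) => [/vu ->|_]; rewrite ?addn0.
Qed.

Lemma mset_le u m : (mset u <= m)%MM = (u \subset supp m).
Proof.
apply/mnm_lepP/subsetP => h x.
  by move=> xu; have := h x; rewrite mnmE xu inE -lt0n.
by rewrite mnmE; case: (boolP (x \in u)) => // /h; rewrite inE -lt0n.
Qed.

Lemma mon_ofE (k : fieldType) u : mon_of k u = ('X_[mset u])%R.
Proof.
rewrite mpolyXE_id /mon_of [LHS]big_mkcond; apply: eq_bigr => x _.
by rewrite mnmE; case: (x \in u); rewrite ?expr1 ?expr0.
Qed.

End Monomials.

(** * Realization over the polynomial ring, one multidegree at a time *)

Section Realization.
Local Open Scope ring_scope.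
Variables (k : fieldType) (n : nat).
Local Notation S := {mpoly k[n]}.

Lemma mcoeffMX_neq0 (f : S) m m' : (f * 'X_[m])@_m' != 0 -> (m <= m')%MM.
Proof.
rewrite -mcoeff_msupp (perm_mem (msuppMX _ _)) => /mapP[m'' _ ->].
by rewrite lem_addr.
Qed.

Variable K : labelled_complex k 'I_n.
Variable U : pred {set 'I_n}.
Hypothesis hK : resolves K U.

Definition rdif i : 'M[S]_(rk K i.+1, rk K i) :=
  \matrix_(p, q) (df K i p q *: 'X_[mset (lab p :\: lab q)]).

(* The component of [v] in multidegree [m]; the factor ['X_[mset (lab p)]]
   accounts for the shift of the generator [p]. *)
Definition strand i (v : 'rV[S]_(rk K i)) m : 'rV[k]_(rk K i) :=
  \row_p (v 0 p * 'X_[mset (lab p)])@_m.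

Lemma strandD i (v w : 'rV[S]_(rk K i)) m :
  strand (v + w) m = strand v m + strand w m.
Proof. by apply/rowP => p; rewrite !mxE mulrDl mcoeffD. Qed.

Lemma strand_supported i (v : 'rV[S]_(rk K i)) m : supported (supp m) (strand v m).
Proof. by move=> p; rewrite mxE => /mcoeffMX_neq0; rewrite mset_le. Qed.

Lemma strand_inj i (v w : 'rV[S]_(rk K i)) : strand v =1 strand w -> v = w.
Proof.
move=> e; apply/rowP => p; apply/mpolyP => m.
have /rowP/(_ p) := e (mset (lab p) + m)%MM.
by rewrite !mxE !mcoeffMX.
Qed.

(** The monomial [lab p / lab q] makes up for the difference of the shifts. *)
Lemma strand_mul i (v : 'rV[S]_(rk K i.+1)) m :
  strand (v *m rdif i) m = strand v m *m df K i.
Proof.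
apply/rowP => q; rewrite !mxE mulr_suml raddf_sum /=; apply: eq_bigr => p _.
rewrite !mxE; have [->|c0] := eqVneq (df K i p q) 0.
  by rewrite scale0r mulr0 mul0r mcoeff0 mulr0.
rewrite -mulrA -scalerAl -mpolyXD msetD ?(res_sub hK) // -scalerAr mcoeffZ.
exact: mulrC.
Qed.

Lemma strand_lift i (v : 'rV[k]_(rk K i)) m : supported (supp m) v ->
  exists w : 'rV[S]_(rk K i), forall m', strand w m' = if m' == m then v else 0.
Proof.
move=> hv; exists (\row_p (v 0 p *: 'X_[m - mset (lab p)])) => m'.
apply/rowP => p; rewrite !mxE -scalerAl mcoeffZ -mpolyXD.
have [v0|v0] := eqVneq (v 0 p) 0.
  by rewrite v0 mul0r; case: ifP; rewrite ?v0 // mxE.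
rewrite submK ?mset_le ?hv // mcoeffX eq_sym.
by case: ifP; rewrite ?mulr1 ?mulr0 ?mxE.
Qed.

(** An equation over [S] splits into equations over [k], one for each of the finitely many
    multidegrees occurring in [v]. *)
Lemma strand_solve i (v : 'rV[S]_(rk K i)) :
  (forall m, exists2 v', supported (supp m) v' & strand v m = v' *m df K i) ->
  exists w, v = w *m rdif i.
Proof.
move=> sol.
have partial (s : seq 'X_{1..n}) : uniq s -> exists w,
    forall m, strand (w *m rdif i) m = if m \in s then strand v m else 0.
  elim: s => [_|m s IH /= /andP[ms /IH[w hw]]].
    exists 0 => m; rewrite mul0mx in_nil; apply/rowP => p.
    by rewrite !mxE mul0r mcoeff0.
  have [v' /strand_lift[w' hw'] ev'] := sol m.
  exists (w' + w) => m'; rewrite mulmxDl strandD hw strand_mul hw' inE.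
  have [->|_] := eqVneq m' m; first by rewrite (negPf ms) addr0 ev'.
  by rewrite mul0mx add0r.
pose s := undup (flatten [seq msupp (v 0 p * 'X_[mset (lab p)]) | p : 'I_(rk K i)]).
have [w hw] := partial s (undup_uniq _).
exists w; apply: strand_inj => m; rewrite hw; case: ifP => // ms.
apply/rowP => p; rewrite !mxE; apply/eqP; rewrite mcoeff_eq0.
apply: contraFN ms => pm; rewrite mem_undup; apply/flatten_mapP.
by exists p; rewrite ?mem_enum.
Qed.

Variable I : S -> Prop.
Hypothesis hI : forall f, I f <-> {in msupp f, forall m, U (supp m)}.

Lemma rdif_graded i (p : 'I_(rk K i.+1)) q m :
  m \in msupp (rdif i p q) -> (mdeg m + #|lab q|)%N = #|lab p|.
Proof.
rewrite mxE mcoeff_msupp mcoeffZ mcoeffX.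
have [->|c0] := eqVneq (df K i p q) 0; first by rewrite mul0r eqxx.
case: (_ =P m) => [<- _|]; last by rewrite mulr0 eqxx.
by rewrite -!mdeg_mset -mdegD msetD ?(res_sub hK).
Qed.

Lemma rdif_exact0 (v : 'rV_(rk K 0)) :
  (forall q, I (v 0 q)) <-> exists w, v = w *m rdif 0.
Proof.
split=> [Iv|[w ->] q].
  apply: strand_solve => m; have [Um|nUm] := boolP (U (supp m)).
    exact: (res_onto hK).
  exists 0; first by move=> q; rewrite mxE eqxx.
  apply/rowP => q; rewrite mul0mx !mxE (res_lab0 hK).
  have -> : mset (set0 : {set 'I_n}) = 0%MM by apply/mnmP => x; rewrite !mnmE inE.
  rewrite mpolyX0 mulr1; apply/eqP; rewrite mcoeff_eq0.
  by apply: contra nUm => mq; apply: (hI _).1 (Iv q) _ mq.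
apply/hI => m mq; apply: (res_image hK (@strand_supported _ w m)).
rewrite -strand_mul; apply: contraTneq mq => /rowP/(_ q).
rewrite !mxE (res_lab0 hK).
have -> : mset (set0 : {set 'I_n}) = 0%MM by apply/mnmP => x; rewrite !mnmE inE.
by rewrite mpolyX0 mulr1 => /eqP; rewrite mcoeff_eq0.
Qed.

Lemma rdif_exactS i (v : 'rV_(rk K i.+1)) :
  v *m rdif i = 0 <-> exists w, v = w *m rdif i.+1.
Proof.
have strand0 j m : strand (0 : 'rV_(rk K j)) m = 0.
  by apply/rowP => q; rewrite !mxE mul0r mcoeff0.
split=> [v0|[w ->]].
  apply: strand_solve => m; apply: (res_exact hK); first exact: strand_supported.
  by rewrite -strand_mul v0 strand0.
apply: strand_inj => m; rewrite !strand_mul -mulmxA (res_df_df hK) mulmx0.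
by rewrite strand0.
Qed.

Definition realize : graded_free_res I :=
  @GradedFreeRes _ _ _ (rk K) (fun i p => #|lab p|) rdif (res_rk0 hK)
    (fun q => etrans (congr1 (fun u : {set 'I_n} => #|u|) (res_lab0 hK q)) (cards0 _))
    rdif_graded rdif_exact0 rdif_exactS.

Lemma realize_minimal : lminimal K -> gminimal realize.
Proof.
move=> minK i p q; rewrite mxE mcoeffZ mcoeffX.
have [->|c0] := eqVneq (df K i p q) 0; first by rewrite mul0r.
case: eqP => [e|]; last by rewrite mulr0.
case/eqP: (minK _ _ _ c0); apply/eqP; rewrite eqEsubset (res_sub hK c0).
by rewrite -setD_eq0 -cards_eq0 -mdeg_mset e mdeg0.
Qed.

End Realization.

(** * Localization and mapping cones *)

(** The recursion runs over consecutive related pairs; a boolean [R] on choice types permits the use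
    of [xchoose]. *)
Lemma dependent_choice (M : nat -> choiceType) (R : forall i, M i -> M i.+1 -> bool)
    (x0 : M 0) :
  (exists y, R 0 x0 y) -> (forall i x y, R i x y -> exists z, R i.+1 y z) ->
  exists f : forall i, M i, f 0 = x0 /\ forall i, R i (f i) (f i.+1).
Proof.
move=> R0 RS.
pose state i := {xy : M i * M i.+1 | R i xy.1 xy.2}.
pose step i (s : state i) : state i.+1 :=
  exist _ ((sval s).2, xchoose (RS i _ _ (svalP s))) (xchooseP (RS i _ _ (svalP s))).
pose g := nat_rect state (exist _ (x0, xchoose R0) (xchooseP R0)) step.
exists (fun i => (sval (g i)).1); split=> // i.
exact: (svalP (g i)).
Qed.

Section Cones.
Local Open Scope ring_scope.
Variables (k : fieldType) (T : finType).
Implicit Types (K L : labelled_complex k T) (U : pred {set T}) (w X : {set T}).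

(** The variables in [X] are set to 1. *)
Definition localize K X : labelled_complex k T :=
  LabelledComplex (fun i (p : 'I_(rk K i)) => lab p :\: X) (df K).

(** [lab p :\: X] lies in [w] exactly when [lab p] lies in [X :|: w], so exactness at [w] is that of
    [K] at [X :|: w]. *)
Lemma localize_resolves K U X :
  resolves K U -> resolves (localize K X) (fun w => U (X :|: w)).
Proof.
case=> rk0 lab0 sub cx onto im ex.
have suppE i w v : @supported _ _ (localize K X) i w v <-> @supported _ _ K i (X :|: w) v.
  by split=> h q /h; rewrite subDset.
split=> //.
- by move=> q; rewrite /= lab0 set0D.
- by move=> i p q /sub h; apply: setSD.
- by move=> w v /(onto _ v)[v' hv' e]; exists v' => //; apply/suppE.
- by move=> w v /suppE; apply: im.
- by move=> i w v /suppE hv /(ex _ _ _ hv)[v' hv' e]; exists v' => //; apply/suppE.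
Qed.

Lemma supported_row (K : labelled_complex k T) i (p : 'I_(rk K i.+1)) :
  supported (lab p) (delta_mx 0 p : 'rV[k]_(rk K i.+1)).
Proof.
by move=> q; rewrite mxE eqxx /=; case: (q =P p) => [->|]; rewrite ?eqxx.
Qed.

Section ChainMap.
Variables (K L : labelled_complex k T) (U V : pred {set T}) (F : {set T}).
Hypotheses (hK : resolves K U) (hL : resolves L V).
Hypothesis UV : forall w, V w = U (F :|: w).

Lemma rows_solve i r (M : 'M[k]_(r, rk K i)) (l : 'I_r -> {set T}) :
  (forall p, exists2 v : 'rV_(rk K i.+1), supported (l p) v & row p M = v *m df K i) ->
  exists W : 'M_(r, rk K i.+1),
    [forall p, forall q, (W p q != 0) ==> (lab q \subset l p)] && (W *m df K i == M).
Proof.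
move=> h; have /fin_all_exists[f hf] : forall p, exists v : 'rV_(rk K i.+1),
    supported (l p) v /\ row p M = v *m df K i.
  by move=> p; have [v] := h p; exists v.
exists (\matrix_p f p); apply/andP; split.
  apply/forallP => p; apply/forallP => q; apply/implyP; rewrite mxE.
  exact: (hf p).1.
apply/eqP/row_matrixP => p; rewrite row_mul rowK.
by rewrite -(hf p).2.
Qed.

(** As [V] is the colon of [U] by [F], multiplication by [F] maps the quotient resolved by [L] to
    the one resolved by [K], and it lifts to the resolutions degree by degree. *)
Lemma lift_chain : exists phi : forall i, 'M[k]_(rk L i, rk K i),
  [/\ phi 0%N = const_mx 1,
      forall i p q, phi i p q != 0 -> lab q \subset F :|: lab p &
      forall i, phi i.+1 *m df K i = df L i *m phi i].
Proof.
pose R i (x : 'M[k]_(rk L i, rk K i)) (y : 'M[k]_(rk L i.+1, rk K i.+1)) :=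
  [forall p, forall q, (y p q != 0) ==> (lab q \subset F :|: lab p)] &&
  (y *m df K i == df L i *m x).
have [||f [f0 fR]] := @dependent_choice (fun i => 'M[k]_(rk L i, rk K i)) R (const_mx 1).
- apply: rows_solve => p.
  (* A non-zero row puts [lab p] in [V], hence [F :|: lab p] in [U], where [df K 0] is onto. *)
  have [e|ne] := eqVneq (row p (df L 0)) 0.
    exists 0; first by move=> q; rewrite mxE eqxx.
    by rewrite row_mul e !mul0mx.
  apply: (res_onto hK); rewrite -UV.
  by apply: (res_image hL (@supported_row L 0 p)); rewrite -rowE.
- move=> i x y /andP[/forallP sy /eqP ey]; apply: rows_solve => p.
  apply: (res_exact hK); last first.
    by rewrite -row_mul -mulmxA ey mulmxA (res_df_df hL) mul0mx row0.
  move=> q; rewrite !mxE => ne.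
  have [j] : exists j, df L i.+1 p j * y j q != 0.
    apply/existsP; apply: contra_neqT ne; rewrite negb_exists => /forallP h.
    by apply: big1 => j _; have := h j; rewrite negbK => /eqP.
  rewrite mulf_eq0 negb_or => /andP[/(res_sub hL) lj yq].
  have /forallP/(_ q)/implyP/(_ yq) := sy j.
  by move/subset_trans; apply; apply: setUS.
- exists f; split=> // [[|i] p q ne|i]; last by have /andP[_ /eqP] := fR i.
    by rewrite (res_lab0 hK) sub0set.
  by have /andP[/forallP/(_ p)/forallP/(_ q)/implyP/(_ ne)] := fR i.
Qed.

Variable phi : forall i, 'M[k]_(rk L i, rk K i).

Definition cone_rk i := if i is j.+1 then (rk K j.+1 + rk L j)%N else rk K 0.

Definition cone_lab i : 'I_(cone_rk i) -> {set T} :=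
  match i with
  | 0 => fun p => lab p
  | j.+1 => fun p => match split p with inl q => lab q | inr q => F :|: lab q end
  end.

Definition cone_df i : 'M[k]_(cone_rk i.+1, cone_rk i) :=
  match i with
  | 0 => col_mx (df K 0) (phi 0)
  | j.+1 => block_mx (df K j.+1) 0 (phi j.+1) (- df L j)
  end.

(* The mapping cone of a lift [phi : L(-F) -> K] of multiplication by [F]. *)
Definition cone : labelled_complex k T := LabelledComplex cone_lab cone_df.

Lemma cone_labl i (q : 'I_(rk K i.+1)) :
  @lab _ _ cone i.+1 (lshift (rk L i) q) = lab q.
Proof. by rewrite /= (unsplitK (inl q)). Qed.

Lemma cone_labr i (q : 'I_(rk L i)) :
  @lab _ _ cone i.+1 (rshift (rk K i.+1) q) = F :|: lab q.
Proof. by rewrite /= (unsplitK (inr q)). Qed.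

Lemma cone_ordP i (P : 'I_(rk cone i.+1) -> Prop) :
  (forall q : 'I_(rk K i.+1), P (lshift (rk L i) q)) ->
  (forall q : 'I_(rk L i), P (rshift (rk K i.+1) q)) -> forall p, P p.
Proof. by move=> hl hr p; case: (split_ordP p) => q ->. Qed.

Hypothesis phi0 : phi 0 = const_mx 1.
Hypothesis phi_sub : forall i p q, phi i p q != 0 -> lab q \subset F :|: lab p.
Hypothesis phi_df : forall i, phi i.+1 *m df K i = df L i *m phi i.

Lemma supported_cone i w (x : 'rV[k]_(rk K i.+1)) (y : 'rV[k]_(rk L i)) :
  @supported _ _ cone i.+1 w (row_mx x y) <->
  supported w x /\ (y != 0 -> F \subset w) /\ supported w y.
Proof.
split=> [h|[hx [yF hy]] q].
  have hy q : y 0 q != 0 -> F :|: lab q \subset w.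
    by move=> yq; have := h (rshift _ q); rewrite row_mxEr cone_labr; apply.
  split; first by move=> q xq; have := h (lshift _ q); rewrite row_mxEl cone_labl; apply.
  split=> [/rV0Pn[q /hy]|q /hy]; rewrite subUset; by case/andP.
apply: (@cone_ordP i (fun q => row_mx x y 0 q != 0 -> lab q \subset w)) => {}q.
  by rewrite row_mxEl cone_labl; apply: hx.
rewrite row_mxEr cone_labr subUset => yq; rewrite hy // yF //.
by apply/rV0Pn; exists q.
Qed.

Lemma cone_sub i (p : 'I_(rk cone i.+1)) (q : 'I_(rk cone i)) :
  df cone i p q != 0 -> lab q \subset lab p.
Proof.
case: i p q => [|i] p.
  by move=> q _; rewrite [lab q](res_lab0 hK) sub0set.
elim/cone_ordP: p => p q; elim/cone_ordP: q => q;
  rewrite ?cone_labl ?cone_labr /= ?block_mxEul ?block_mxEur ?block_mxEdl ?block_mxEdr.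
- exact: (res_sub hK).
- by rewrite mxE eqxx.
- exact: phi_sub.
- by rewrite mxE oppr_eq0 => /(res_sub hL); apply: setUS.
Qed.

Lemma cone_df_df i : df cone i.+1 *m df cone i = 0.
Proof.
case: i => [|i] /=.
  rewrite mul_block_col mul0mx addr0 (res_df_df hK) mulNmx phi_df subrr.
  exact: col_mx0.
rewrite mulmx_block !mul0mx !mulmx0 !addr0 !add0r !(res_df_df hK) mulNmx.
rewrite phi_df subrr mulmxN mulNmx opprK (res_df_df hL).
exact: block_mx0.
Qed.

Lemma mulmx_phi0_eq0 (y : 'rV_(rk L 0)) : y *m phi 0 = 0 -> y = 0.
Proof.
have K0 : (0 < rk K 0)%N by rewrite (res_rk0 hK).
move/rowP/(_ (Ordinal K0)); rewrite phi0 mxE mxE => y0.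
apply/rowP => q; rewrite mxE -[RHS]y0 (bigD1 q) //= big1 => [|j].
  by rewrite mxE mulr1 addr0.
move/eqP; case; apply: val_inj.
have q0 (x : 'I_(rk L 0)) : val x = 0%N.
  by have := ltn_ord x; rewrite [X in (_ < X)%N](res_rk0 hL) ltnS leqn0 => /eqP.
by rewrite !q0.
Qed.

(** With [y = y' *m df L i], the vector [x + y' *m phi i.+1] is a cycle of [K]; if [x'] maps to it,
    then [row_mx x' (- y')] maps to [row_mx x y]. Finding [y'] is left as an assumption, being
    different for [i = 0]. *)
Lemma cone_exact_of i w (x : 'rV[k]_(rk K i.+1)) (y : 'rV[k]_(rk L i)) :
  supported w x -> (y != 0 -> F \subset w) -> x *m df K i + y *m phi i = 0 ->
  (F \subset w -> exists2 y', supported w y' & y = y' *m df L i) ->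
  exists2 v : 'rV_(rk cone i.+2), supported w v & row_mx x y = v *m df cone i.+1.
Proof.
move=> sx Fy exy hy.
have [y' [sy' Fy' ey']] : exists y', [/\ supported w y', y' != 0 -> F \subset w
    & y = y' *m df L i].
  have [y0|/Fy Fw] := eqVneq y 0; last by have [y' ? ?] := hy Fw; exists y'.
  exists 0; split; first by move=> q; rewrite mxE eqxx.
    by rewrite eqxx.
  by rewrite y0 mul0mx.
have [] := res_exact hK (w := w) (v := x + y' *m phi i.+1).
- move=> q; rewrite !mxE => ne.
  have [x0|] := eqVneq (x 0 q) 0; last exact: sx.
  move: ne; rewrite x0 add0r => ne.
  have [j] : exists j, y' 0 j * phi i.+1 j q != 0.
    apply/existsP; apply: contra_neqT ne; rewrite negb_exists => /forallP h.
    by apply: big1 => j _; have := h j; rewrite negbK => /eqP.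
  rewrite mulf_eq0 negb_or => /andP[yj /phi_sub/subset_trans]; apply.
  by rewrite subUset sy' // Fy' //; apply/rV0Pn; exists j.
- by rewrite mulmxDl -mulmxA phi_df mulmxA -ey'.
move=> x' sx' ex'; exists (row_mx x' (- y')).
  apply/supported_cone; split=> //; rewrite oppr_eq0; split=> // q.
  by rewrite mxE oppr_eq0; apply: sy'.
rewrite /= mul_row_block mulmx0 add0r mulNmx -ex' addrK mulNmx mulmxN opprK.
by rewrite -ey'.
Qed.

Lemma cone_resolves : resolves cone (fun w => U w || (F \subset w)).
Proof.
have UVw w : F \subset w -> V w = U w by move=> Fw; rewrite UV (setUidPr Fw).
have suppP i w (v : 'rV_(rk cone i.+1)) : supported w v ->
    exists x y, v = row_mx x y /\ @supported _ _ cone i.+1 w (row_mx x y).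
  by move=> sv; exists (lsubmx v), (rsubmx v); rewrite hsubmxK.
split; first exact: (res_rk0 hK).
- exact: (res_lab0 hK).
- exact: cone_sub.
- exact: cone_df_df.
- move=> w v /orP[/(res_onto hK v)[x sx ex]|Fw].
    exists (row_mx x 0); last by rewrite /= mul_row_col mul0mx addr0.
    apply/supported_cone; rewrite eqxx; split=> //; split=> // q.
    by rewrite mxE eqxx.
  have K0 : (0 < rk K 0)%N by rewrite (res_rk0 hK).
  have L0 : (0 < rk L 0)%N by rewrite (res_rk0 hL).
  (* The generator of [L] in degree 0 becomes one of the cone with label [F] and image 1. *)
  exists (row_mx 0 (\row_q (v 0 (Ordinal K0) *+ (q == Ordinal L0)))).
    apply/supported_cone; split; first by move=> q; rewrite mxE eqxx.
    by split=> // q; rewrite (res_lab0 hL) sub0set.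
  rewrite /= mul_row_col mul0mx add0r phi0; apply/rowP => q.
  rewrite mxE (bigD1 (Ordinal L0)) //= big1 => [|j /negPf nj]; last first.
    by rewrite !mxE nj mulr0n mul0r.
  rewrite !mxE eqxx mulr1n mulr1 addr0; congr (v 0 _); apply: val_inj => /=.
  by have := ltn_ord q; rewrite [X in (_ < X)%N](res_rk0 hK) ltnS leqn0 => /eqP.
- move=> w _ /suppP[x [y [-> /supported_cone[sx [Fy sy]]]]].
  rewrite /= mul_row_col.
  have [->|y0 _] := eqVneq y 0; last by rewrite Fy ?orbT.
  by rewrite mul0mx addr0 => /(res_image hK sx) ->.
- move=> i w _ /suppP[x [y [-> /supported_cone[sx [Fy sy]]]]].
  case: i x y sx Fy sy => [|i] x y sx Fy sy.
    rewrite /= mul_row_col => e; apply: cone_exact_of => // Fw.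
    (* Here [y] has degree 0 in [L]. If it is non-zero, so is the image of [x], which forces [U w],
       hence [V w], and [y] is a boundary. *)
    have [->|y0] := eqVneq y 0.
      by exists 0; rewrite ?mul0mx // => q; rewrite mxE eqxx.
    apply: (res_onto hL); rewrite UVw //; apply: (res_image hK sx).
    apply: contra_neq y0 => x0; apply: mulmx_phi0_eq0.
    by rewrite x0 add0r in e.
  rewrite /= mul_row_block mulmx0 add0r mulmxN -row_mx0 => /eq_row_mx[e /eqP].
  rewrite oppr_eq0 => /eqP ey; apply: cone_exact_of => // Fw.
  exact: (res_exact hL).
Qed.

(** [x0] lies in every label coming from [L] and in none coming from [K], so no entry of [phi] is a
    unit. Labels of [L] are recovered by removing [F], so [L] stays minimal inside the cone. *)
Lemma cone_minimal (x0 : T) :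
  x0 \in F -> (forall i (p : 'I_(rk K i)), x0 \notin lab p) ->
  (forall i (p : 'I_(rk L i)), [disjoint lab p & F]) ->
  lminimal K -> lminimal L -> lminimal cone.
Proof.
move=> x0F x0K LF minK minL i p q.
have neq j j' (r : 'I_(rk L j)) (s : 'I_(rk K j')) : lab s != F :|: lab r.
  by apply: contraNneq (x0K _ s) => ->; rewrite inE x0F.
case: i p q => [|i] p q; elim/cone_ordP: p => p.
- by rewrite cone_labl /= col_mxEu; apply: minK.
- by rewrite cone_labr /= => _; apply: neq.
- elim/cone_ordP: q => q; rewrite ?cone_labl ?cone_labr /= ?block_mxEul ?block_mxEur.
    exact: minK.
  by rewrite mxE eqxx.
- elim/cone_ordP: q => q; rewrite ?cone_labl ?cone_labr /= ?block_mxEdl ?block_mxEdr.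
    by move=> _; apply: neq.
  rewrite mxE oppr_eq0 => /minL; apply: contra_neq => e.
  have FK j (r : 'I_(rk L j)) : (F :|: lab r) :\: F = lab r.
    by rewrite setDUl setDv set0U; apply/setDidPl.
  by rewrite -(FK _ q) e FK.
Qed.

End ChainMap.
End Cones.

(** * Forests *)

Section Forests.
Variable T : finType.
Implicit Types (A B : {set {set T}}) (F G H X w : {set T}) (D E : {set {set T}}).

(* Members of [A] may contain one another, so that the notion is preserved by
   [H |-> H :\: X]. *)
Definition forest A : Prop :=
  forall B, B \subset A -> B != set0 -> exists2 F, F \in B &
    B = [set F] \/
    exists G, [/\ G \in B, G != F & forall H, H \in B -> H != F -> F :&: H \subset G].

Lemma forest_sub A B : B \subset A -> forest A -> forest B.
Proof. by move=> BA fA C CB; apply: fA; apply: subset_trans CB BA. Qed.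

(** Choosing one preimage in [A] for every member of [B] makes removal of [X] injective on the
    chosen sets; a leaf among these gives a leaf of [B]. *)
Lemma forest_setD A X : forest A -> forest [set H :\: X | H in A].
Proof.
move=> fA B BA B0.
pose r H' := odflt H' [pick H in A | H :\: X == H'].
have rP H' : H' \in B -> r H' \in A /\ r H' :\: X = H'.
  move=> /(subsetP BA)/imsetP[H HA ->]; rewrite /r; case: pickP => [G|/(_ H)].
    by case/andP=> GA /eqP.
  by rewrite HA eqxx.
have [||F /imsetP[F' F'B ->] FP] := fA (r @: B).
- by apply/subsetP => _ /imsetP[H /rP[rA _] ->].
- by case/set0Pn: B0 => H HB; apply/set0Pn; exists (r H); apply: imset_f.
exists F' => //; case: FP => [e|[G [/imsetP[G' G'B ->] GF GP]]].
  left; apply/setP => H; rewrite inE; apply/idP/eqP => [HB|->] //.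
  have : r H \in r @: B by apply: imset_f.
  by rewrite e inE => /eqP eH; rewrite -(rP _ HB).2 eH (rP _ F'B).2.
right; exists G'; split=> // [|H HB HF]; first by apply: contraNneq GF => ->.
have /(setSD X) : r F' :&: r H \subset r G'.
  apply: GP; first exact: imset_f.
  by apply: contraNneq HF => e; rewrite -(rP _ HB).2 e (rP _ F'B).2.
by rewrite setDIl (rP _ HB).2 (rP _ F'B).2 (rP _ G'B).2.
Qed.

Lemma facets_antichain D F G :
  F \in facets D -> G \in facets D -> F \subset G -> F = G.
Proof.
rewrite !inE => /maxsetP[_ hF] /maxsetP[GD _] FG.
by rewrite (hF _ GD FG).
Qed.

(** The complex [E] generated by [B] has exactly the facets [B], because the facets of [D] form an
    antichain. *)
Lemma simplicial_forest_facets D : simplicial_forest D -> forest (facets D).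
Proof.
case=> _ leafD B BD B0; pose E := [set G : {set T} | [exists H in B, G \subset H]].
have BE H : H \in B -> H \in E by move=> HB; rewrite inE; apply/existsP; exists H; rewrite HB /=.
have fE : facets E = B.
  apply/setP => H; rewrite inE; apply/maxsetP/idP => [[]|HB].
    rewrite inE => /existsP[G /andP[GB HG]] /(_ G (BE _ GB) HG) eG.
    by rewrite -eG.
  split; first exact: BE.
  move=> G; rewrite inE => /existsP[G' /andP[G'B GG']] HG.
  have e : H = G'.
    by apply: (facets_antichain (subsetP BD _ HB) (subsetP BD _ G'B));
      apply: subset_trans HG GG'.
  by apply/eqP; rewrite eqEsubset HG {1}e GG'.
have [||F] := leafD E.
- split; last by rewrite fE.
  move=> G H; rewrite !inE => /existsP[G' /andP[G'B GG']] HG.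
  by apply/existsP; exists G'; rewrite G'B (subset_trans HG).
- by case/set0Pn: B0 => H HB; apply/set0Pn; exists H; apply: BE.
by rewrite /leaf fE => -[FB FP]; exists F.
Qed.

Lemma up_setD1 A G H : H \in A -> H != G -> H \subset G -> up (A :\ G) =1 up A.
Proof.
move=> HA HG sHG w; apply/existsP/existsP => -[X /andP[XA Xw]].
  by exists X; rewrite Xw andbT; move: XA; rewrite inE => /andP[].
have [eX|XG] := eqVneq X G; last by exists X; rewrite !inE XG XA.
by exists H; rewrite !inE HG HA (subset_trans sHG) // -eX.
Qed.

Lemma up_split A F w : F \in A -> up A w = up (A :\ F) w || (F \subset w).
Proof.
move=> FA; apply/existsP/orP => [[X /andP[XA Xw]]|[/existsP[X]|Fw]].
- have [<-|XF] := eqVneq X F; first by right.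
  by left; apply/existsP; exists X; rewrite !inE XF XA.
- by rewrite !inE -andbA => /and3P[_ XA Xw]; exists X; rewrite XA.
- by exists F; rewrite FA.
Qed.

(** The sets [H :\: F] generate the colon ideal by the monomial of [F]. *)
Lemma up_setD B F w : up [set H :\: F | H in B] w = up B (F :|: w).
Proof.
apply/existsP/existsP => [[_ /andP[/imsetP[X XB ->]]]|[X /andP[XB Xw]]].
  by rewrite subDset => Xw; exists X; rewrite XB.
exists (X :\: F); rewrite subDset Xw andbT; exact: imset_f.
Qed.

(** Every other member meets the leaf [F] inside [G], and the antichain property gives a vertex of
    [F] outside [G]. *)
Lemma leaf_free_vertex A : set0 \notin A ->
  {in A &, forall H G, H \subset G -> H = G} -> forest A -> A != set0 ->
  exists2 F, F \in A & exists2 x, x \in F & x \notin cover (A :\ F).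
Proof.
move=> A0 anti fA An0; have [F FA FP] := fA A (subxx _) An0; exists F => //.
case: FP => [eA|[G [GA GF GP]]].
  have /set0Pn[x xF] : F != set0 by apply: contraNneq A0 => <-.
  exists x => //; apply/bigcupP => -[H].
  by rewrite eA !inE => /andP[/negPf->].
have /subsetPn[x xF xG] : ~~ (F \subset G).
  by apply: contra GF => /(anti _ _ FA GA) ->.
exists x => //; apply/bigcupP => -[H]; rewrite !inE => /andP[HF HA] xH.
by case/negP: xG; apply: (subsetP (GP _ HA HF)); rewrite inE xF.
Qed.

End Forests.

(** * Subadditivity for forests *)

Section Subadditivity.
Local Open Scope ring_scope.
Variables (k : fieldType) (n : nat).
Implicit Types (A B : {set {set 'I_n}}).

(** Stated for each generator, the inequality avoids maxima over possibly empty sets. *)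
Definition subadditive (K : labelled_complex k 'I_n) : Prop :=
  forall a b (p : 'I_(rk K (a + b))), (0 < a)%N -> (0 < b)%N ->
  exists (q : 'I_(rk K a)) (r : 'I_(rk K b)), (#|lab p| <= #|lab q| + #|lab r|)%N.

(** Both complexes are realized over the polynomial ring as resolutions for one ideal, where the
    comparison theorem applies. *)
Lemma resolves_lminimal_card (K L : labelled_complex k 'I_n) U i (p : 'I_(rk L i)) :
  resolves K U -> resolves L U -> lminimal L ->
  exists q : 'I_(rk K i), #|lab q| = #|lab p|.
Proof.
move=> hK hL minL.
pose I (f : {mpoly k[n]}) := {in msupp f, forall m, U (supp m)}.
have hI f : I f <-> {in msupp f, forall m, U (supp m)} by [].
have minG : gminimal (realize hL hI) := realize_minimal minL.
by have [q e] := gminimal_shift (realize hK hI) minG p; exists q.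
Qed.

Lemma cone_subadditive (K L : labelled_complex k 'I_n) U V F
    (phi : forall i, 'M[k]_(rk L i, rk K i)) :
  resolves K U -> resolves L V -> (forall w, V w = U (F :|: w)) ->
  (forall i (p : 'I_(rk L i)), [disjoint lab p & F]) ->
  lminimal L -> subadditive K -> subadditive L -> subadditive (cone F phi).
Proof.
move=> hK hL UV LF minL subK subL a b p.
case: a b p => // a [|b] // p _ _.
have cardF i (q : 'I_(rk L i)) : #|F :|: lab q| = (#|F| + #|lab q|)%N.
  by rewrite cardsU disjoint_setI0 ?cards0 ?subn0 // disjoint_sym.
elim/cone_ordP: p => p.
  have [q [r h]] := subK a.+1 b.+1 p isT isT.
  exists (lshift (rk L a) q), (lshift (rk L b) r).
  by rewrite !cone_labl.
(* Setting the variables of [F] to 1 in [K] yields a resolution of the ideal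
   resolved by [L]. *)
have KL i (q : 'I_(rk L i)) : exists r : 'I_(rk K i), #|lab r :\: F| = #|lab q|.
  apply: (@resolves_lminimal_card (localize K F) L V) => //.
  by apply: eq_resolves (localize_resolves F hK) => w; rewrite UV.
(* The indices are shifted by one. If the first is 1 in the cone, its generator with label [F]
   accounts for [#|F|], and a generator of [K] for the rest. *)
case: a p => [|a] p.
  have [r er] := KL _ p.
  have L0 : (0 < rk L 0)%N by rewrite (res_rk0 hL).
  exists (rshift (rk K 1) (Ordinal L0)), (lshift (rk L b) r).
  rewrite !cone_labr !cone_labl (res_lab0 hL) setU0 cardF leq_add2l -er.
  exact/subset_leq_card/subsetDl.
(* Now [p] splits in [L]: [q] gains [F] and moves up one degree in the cone, while [r] is replaced
   by a generator of [K]. *)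
have [q [r h]] := subL a.+1 b.+1 p isT isT.
have [r' er'] := KL _ r.
exists (rshift (rk K a.+2) q), (lshift (rk L b) r').
rewrite !cone_labr !cone_labl !cardF -addnA leq_add2l (leq_trans h) // leq_add2l -er'.
exact/subset_leq_card/subsetDl.
Qed.

Definition trivial_complex : labelled_complex k 'I_n :=
  @LabelledComplex k 'I_n (fun i => (i == 0)%N : nat) (fun _ _ => set0) (fun _ => 0).

(** Induction on the number of members. The bound of the labels by [cover A] is carried along: it
    keeps the free vertex [x] out of the labels of [K] and makes those of [L] disjoint from [F]. *)
Lemma forest_resolution A : forest A -> set0 \notin A ->
  exists K, [/\ resolves K (up A), lminimal K, subadditive K &
    forall i (p : 'I_(rk K i)), lab p \subset cover A].
Proof.
have [m] := ubnP #|A|; elim: m A => // m IH A; rewrite ltnS => Am fA A0.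
have cover_sub B : B \subset A -> cover B \subset cover A.
  by move=> /subsetP BA; apply/bigcupsP => H /BA HA; apply: bigcup_sup.
have [eA|An0] := eqVneq A set0.
  exists trivial_complex; split.
  - have upA w : up A w = false.
      by apply/existsP => -[H]; rewrite eA inE.
    split=> //.
    + by move=> i; rewrite mul0mx.
    + by move=> w v; rewrite upA.
    + by move=> w v _; rewrite mulmx0 eqxx.
    + move=> i w v _ _; exists 0; first by move=> q; rewrite mxE eqxx.
      by apply/rowP => -[].
  - by move=> i p q; rewrite mxE eqxx.
  - by move=> [|a] // b [].
  - by move=> i p; rewrite sub0set.
(* A member containing another one is redundant for the ideal and is deleted. *)
have [/existsP[G /andP[GA /existsP[H /and3P[HA HG sHG]]]]|anti] :=
  boolP [exists G in A, exists H, [&& H \in A, H != G & H \subset G]].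
  have AG : (#|A :\ G| < m)%N.
    by rewrite (leq_trans _ Am) // [in X in (_ < X)%N](cardsD1 G) GA.
  have [||K [hK minK subK covK]] := IH _ AG.
  - exact: forest_sub (subsetDl _ _) fA.
  - by rewrite !inE (negPf A0) andbF.
  exists K; split=> //; first exact: eq_resolves (up_setD1 HA HG sHG) hK.
  by move=> i p; apply: subset_trans (covK i p) (cover_sub _ (subsetDl _ _)).
have {}anti : {in A &, forall H G : {set 'I_n}, H \subset G -> H = G}.
  move=> H G HA GA sHG; apply/eqP; apply: contraNT anti => HG.
  by apply/existsP; exists G; rewrite GA; apply/existsP; exists H; rewrite HA HG.
have [F FA [x xF xB]] := leaf_free_vertex A0 anti fA An0.
pose B := A :\ F; pose C := [set H :\: F | H in B].
have Bm : (#|B| < m)%N.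
  by rewrite (leq_trans _ Am) // [in X in (_ < X)%N](cardsD1 F) FA.
have fB : forest B := forest_sub (subsetDl _ _) fA.
have [|K [hK minK subK covK]] := IH B Bm fB.
  by rewrite !inE (negPf A0) andbF.
have [||L [hL minL subL covL]] := IH C (leq_ltn_trans (leq_imset_card _ _) Bm).
- exact: forest_setD.
(* Were [H :\: F] empty, [H] would lie in [F], against the antichain property. *)
- apply/imsetP => -[H]; rewrite !inE => /andP[HF HA] /esym/eqP.
  by rewrite setD_eq0 => /(anti _ _ HA FA) e; rewrite e eqxx in HF.
have UV w : up C w = up B (F :|: w) by rewrite up_setD.
have LF i (p : 'I_(rk L i)) : [disjoint lab p & F].
  rewrite disjoints_subset; apply: subset_trans (covL i p) _.
  by apply/bigcupsP => _ /imsetP[H _ ->]; rewrite setDE subsetIr.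
have [phi [phi0 phi_sub phi_df]] := lift_chain hK hL UV.
exists (cone F phi); split.
- apply: eq_resolves (cone_resolves hK hL UV phi0 phi_sub phi_df) => w.
  by rewrite (up_split w FA).
- apply: (cone_minimal xF _ LF) => // i p.
  by apply: contra xB; apply: (subsetP (covK i p)).
- exact: cone_subadditive hK hL UV LF minL subK subL.
have KA i (p : 'I_(rk K i)) : lab p \subset cover A.
  by apply: subset_trans (covK i p) (cover_sub _ (subsetDl _ _)).
case=> [|i]; first exact: KA.
elim/cone_ordP => p; first by rewrite cone_labl; apply: KA.
rewrite cone_labr subUset bigcup_sup //=.
apply: subset_trans (covL i p) _; apply/bigcupsP => _ /imsetP[H HB ->].
apply: subset_trans (subsetDl _ _) _; apply: bigcup_sup.
by move: HB; rewrite inE => /andP[].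
Qed.

End Subadditivity.

(** * Facet ideals and the given minimal resolution *)

Section FacetIdeals.
Local Open Scope ring_scope.
Variables (k : fieldType) (n : nat) (D : {set {set 'I_n}}).
Local Notation I := (@facet_ideal k n D).

(** A monomial ideal contains [f] when it contains each term, and each term is a multiple of the
    monomial of one facet. *)
Lemma facet_idealP f :
  I f <-> {in msupp f, forall m, up (facets D) (supp m)}.
Proof.
split=> [[c ->] m|hf].
  move=> /msupp_sum_le /flatten_mapP[H].
  rewrite mem_filter mon_ofE => /andP[HD _].
  rewrite mcoeff_msupp => /mcoeffMX_neq0; rewrite mset_le => Hm.
  by apply/existsP; exists H; rewrite HD.
rewrite (mpolyE f) big_seq; apply: big_ind => [|g h [c ->] [d ->]|m mf].
- by exists (fun=> 0); rewrite big1 // => H _; rewrite mul0r.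
- exists (fun H => c H + d H); rewrite -big_split.
  by apply: eq_bigr => H _; rewrite mulrDl.
have /existsP[H /andP[HD Hm]] := hf m mf.
exists (fun G => if G == H then f@_m *: 'X_[m - mset H] else 0).
rewrite (bigD1 H) //= eqxx big1 => [|G /andP[_ /negPf->]]; last by rewrite mul0r.
by rewrite addr0 mon_ofE -scalerAl -mpolyXD submK ?mset_le.
Qed.

Definition graded_of_min (F : min_graded_free_res I) : graded_free_res I :=
  GradedFreeRes (@rank0 _ _ _ F) (@shift0 _ _ _ F) (@dif_graded _ _ _ F)
    (@exact0 _ _ _ F) (@exactS _ _ _ F).

Lemma gminimal_graded_of_min F : gminimal (graded_of_min F).
Proof. exact: dif_minimal. Qed.

(* For the unit ideal, minimality would contradict the rank 1 in degree 0. *)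
Lemma min_res_set0_notin (F : min_graded_free_res I) : set0 \notin facets D.
Proof.
apply/negP => D0.
have /exact0[w /rowP e] : forall q, I ((const_mx 1 : 'rV_(rank F 0)) 0 q).
  move=> q; apply/facet_idealP => m _; apply/existsP.
  by exists set0; rewrite D0 sub0set.
have F0 : (0 < rank F 0)%N by rewrite rank0.
have := congr1 (mcoeff 0%MM) (e (Ordinal F0)).
rewrite mcoeff0_mulmx mxE mcoeff1 eqxx big1 => [/eqP|j _]; last first.
  by rewrite dif_minimal mulr0.
by rewrite oner_eq0.
Qed.

End FacetIdeals.

Lemma shift_le_max_degree (k : fieldType) n (I : {mpoly k[n]} -> Prop)
    (F : min_graded_free_res I) a (p : 'I_(rank F a)) : shift p <= max_degree F a.
Proof.
have Fa : rank F a != 0 by rewrite -lt0n (leq_ltn_trans _ (ltn_ord p)).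
by apply: (max_degreeP Fa).2; rewrite betti_neq0; apply: codom_f.
Qed.

Theorem theorem3p7 (k : fieldType) (n : nat) (D : {set {set 'I_n}})
    (hD : simplicial_forest D)
    (F : min_graded_free_res (@facet_ideal k n D))
    (p : nat) (hp : projdim F p)
    (i a b : nat) (hip : i <= p) (hab : i = a + b) (ha : 0 < a) (hb : 0 < b) :
  max_degree F (a + b) <= max_degree F a + max_degree F b.
Proof.
have [K [hK minK subK _]] := forest_resolution k
  (simplicial_forest_facets hD) (min_res_set0_notin F).
pose G := realize hK (@facet_idealP k n D).
have rkF : rank F (a + b) != 0 by apply: projdim_rank_neq0 hp _ _; rewrite -hab.
have := (max_degreeP rkF).1; rewrite betti_neq0 => /codomP[s ->].
(* Minimality of [F] makes its top shift in degree [a + b] occur in [G]. *)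
have [s' /= <-] := gminimal_shift G (gminimal_graded_of_min (F := F)) s.
have [q [r h]] := subK a b s' ha hb; apply: (leq_trans h).
(* Conversely, minimality of [G] makes the degrees of [q] and [r] occur in [F]. *)
have minG : gminimal G := realize_minimal minK.
have [q' /= <-] := gminimal_shift (graded_of_min F) minG q.
have [r' /= <-] := gminimal_shift (graded_of_min F) minG r.
by apply: leq_add; apply: shift_le_max_degree.
Qed.
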